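(* Let $R$ be a left Artinian ring, let $n$ be the length of $\operatorname{socle}(R)$ as an $(R,R)$-bimodule (equivalently, as a two-sided ideal), and let $M$ be a faithful left $R$-module. Then: (i) $M$ has a submodule $M'$ which is again faithful over $R$, and satisfies $\operatorname{length}(M'/J(R)M')\leq n$. (In particular, $M'$ is generated by $\leq n$ elements.) (ii) $M$ has a homomorphic image $M''$ which is faithful over $R$, and satisfies $\operatorname{length}(\operatorname{socle}(M''))\leq n$. (iii) $M$ has a subfactor $P$ (a homomorphic image of a submodule) which is faithful over $R$ and satisfies both $\operatorname{length}(P/J(R)P)\leq n$ and $\operatorname{length}(\operatorname{socle}(P))\leq n$.
   Context: Rings are associative and unital, not assumed commutative. $J(R)$ denotes the Jacobson radical of $R$. The socle of a module is the sum of its simple submodules. The socle of a ring $R$, $\operatorname{socle}(R)$, is the sum of all minimal nonzero two-sided ideals of $R$; for $R$ left or right Artinian it is the intersection of the left and right socles of $R$. Lengths of modules are as left $R$-modules. *)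

(* Defs.v *)
From HB Require Import structures.
From mathcomp Require Import all_boot all_algebra.
From mathcomp Require Import generic_quotient ring_quotient boolp.

Set Implicit Arguments.
Unset Strict Implicit.
Unset Printing Implicit Defensive.

Import GRing.Theory.
Local Open Scope ring_scope.
Local Open Scope quotient_scope.

(* Classical logic is used through boolp: since every Prop-valued
   subset has a boolean characteristic function `[< _ >], the type
   [submodClosed V] ranges over all submodules of the left R-module V.  Two of
   its elements denote the same submodule when they are related by [=i].
   The base rings are [pzRingType]s: unital, not assumed commutative, possibly
   trivial.  Left ideals of R are submodules of the regular left module R^o. *)

Section SubmoduleType.
Variables (R : pzRingType) (V : lmodType R) (N : submodClosed V).

Record submodule : predArgType :=
  Submodule { submodule_val : V; submodule_valP : submodule_val \in N }.

HB.instance Definition _ := [isSub for submodule_val].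
HB.instance Definition _ := [Choice of submodule by <:].
HB.instance Definition _ := [SubChoice_isSubLmodule of submodule by <:].

End SubmoduleType.

Section QuotientModule.
Variables (R : pzRingType) (V : lmodType R) (N : submodClosed V).

(* [submodClosed] does not record closure under opposites, which the quotient
   construction of ring_quotient requires. *)
Definition zmod_of_submod : {pred V} := N.

Fact zmod_of_submod_closed : zmod_closed zmod_of_submod.
Proof. exact: GRing.submod_closedB (submodClosedP N). Qed.

HB.instance Definition _ :=
  GRing.isZmodClosed.Build V zmod_of_submod zmod_of_submod_closed.

Definition quotient_module : Type := Quotient.quot zmod_of_submod.

HB.instance Definition _ := GRing.Zmodule.on quotient_module.
HB.instance Definition _ :=
  ZmodQuotient.on quotient_module.

Definition quotient_scale (a : R) : quotient_module -> quotient_module :=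
  lift_op1 quotient_module ( *:%R a).

Fact pi_quotient_scale (a : R) (x : V) :
  quotient_scale a (\pi_quotient_module x) = \pi_quotient_module (a *: x).
Proof.
have Nx : repr (\pi_quotient_module x) - x \in N.
  have := Quotient.idealrBE zmod_of_submod (repr (\pi_quotient_module x)) x.
  by move=> ->; rewrite reprK.
rewrite /quotient_scale; unlock; apply/eqP.
have := Quotient.idealrBE zmod_of_submod (a *: repr (\pi_quotient_module x)).
by move=> <-; rewrite -scalerBr; exact: (@rpredZ _ _ N).
Qed.

Fact quotient_scaleA (a b : R) (q : quotient_module) :
  quotient_scale a (quotient_scale b q) = quotient_scale (a * b) q.
Proof. by elim/quotW: q => x; rewrite !pi_quotient_scale scalerA. Qed.

Fact quotient_scale1 : left_id 1 quotient_scale.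
Proof. by elim/quotW=> x; rewrite pi_quotient_scale scale1r. Qed.

Fact quotient_scaleDr : right_distributive quotient_scale +%R.
Proof.
move=> a; elim/quotW=> x; elim/quotW=> y.
by rewrite -raddfD !pi_quotient_scale scalerDr raddfD.
Qed.

Fact quotient_scaleDl (q : quotient_module) :
  {morph quotient_scale^~ q : a b / a + b}.
Proof.
elim/quotW: q => x a b /=.
by rewrite !pi_quotient_scale scalerDl raddfD.
Qed.

HB.instance Definition _ := GRing.Zmodule_isLmodule.Build R quotient_module
  quotient_scaleA quotient_scale1 quotient_scaleDr quotient_scaleDl.

End QuotientModule.

Section SumOfSubmodules.
Variables (R : pzRingType) (V : lmodType R).

Definition sum_submod (F : submodClosed V -> Prop) : {pred V} :=
  fun v => `[< exists s : seq V,
    (forall x, x \in s -> exists2 N : submodClosed V, F N & x \in N) /\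
    v = \sum_(x <- s) x >].

Fact sum_submod_closed F : submod_closed (sum_submod F).
Proof.
split=> [|a u v /asboolP[s [Fs ->]] /asboolP[t [Ft ->]]]; apply/asboolP.
  by exists [::]; rewrite big_nil.
exists ([seq a *: x | x <- s] ++ t); split=> [x|].
  rewrite mem_cat => /orP[/mapP[y /Fs[N FN yN] ->]|/Ft//].
  by exists N => //; exact: rpredZ.
by rewrite big_cat big_map scaler_sumr.
Qed.

HB.instance Definition _ F :=
  GRing.isSubmodClosed.Build R V (sum_submod F) (sum_submod_closed F).

Definition simple_submod (N : submodClosed V) : Prop :=
  ~ (N =i pred1 0) /\
  forall D : submodClosed V, {subset D <= N} -> D =i pred1 0 \/ D =i N.

Definition socle : submodClosed V := sum_submod simple_submod.

End SumOfSubmodules.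

Section RingNotions.
Variable R : pzRingType.

Definition left_artinian : Prop :=
  forall I : nat -> submodClosed R^o,
    (forall i, {subset I i.+1 <= I i}) ->
    exists m, forall i, (m <= i)%N -> I i =i I m.

Definition maximal_left_ideal (I : submodClosed R^o) : Prop :=
  ~ (I =i predT) /\
  forall D : submodClosed R^o, {subset I <= D} -> D =i I \/ D =i predT.

Definition jacobson_radical (a : R) : Prop :=
  forall I : submodClosed R^o, maximal_left_ideal I -> (a : R^o) \in I.

Definition two_sided_ideal (I : submodClosed R^o) : Prop :=
  forall a x : R, (x : R^o) \in I -> (x * a : R^o) \in I.

Definition minimal_ideal (I : submodClosed R^o) : Prop :=
  [/\ two_sided_ideal I, ~ (I =i pred1 0)
    & forall D : submodClosed R^o, two_sided_ideal D ->
        {subset D <= I} -> D =i pred1 0 \/ D =i I].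

Definition ring_socle : submodClosed R^o := sum_submod minimal_ideal.

End RingNotions.

Section ModuleNotions.
Variables (R : pzRingType) (V : lmodType R).

Definition faithful : Prop :=
  forall a : R, (forall v : V, a *: v = 0) -> a = 0.

Definition generated_by (s : seq V) : Prop :=
  forall v : V, exists c : 'I_(size s) -> R, v = \sum_i c i *: s`_i.

(* J(R) V, consisting of the finite sums of products a *: v with a in J(R). *)
Definition radical_sums : {pred V} :=
  fun v => `[< exists s : seq (R * V),
    (forall p, p \in s -> jacobson_radical p.1) /\
    v = \sum_(p <- s) p.1 *: p.2 >].

Fact radical_sums_closed : submod_closed radical_sums.
Proof.
split=> [|a u v /asboolP[s [Js ->]] /asboolP[t [Jt ->]]]; apply/asboolP.
  by exists [::]; rewrite big_nil.
exists ([seq (a * p.1, p.2) | p <- s] ++ t); split=> [p|].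
  rewrite mem_cat => /orP[/mapP[q /Js Jq ->] I mI|/Jt//].
  exact: (@rpredZ _ _ I a q.1 (Jq I mI)).
rewrite big_cat big_map scaler_sumr; congr (_ + _).
by apply: eq_bigr => p _; rewrite scalerA.
Qed.

HB.instance Definition _ :=
  GRing.isSubmodClosed.Build R V radical_sums radical_sums_closed.

Definition radical_submod : submodClosed V := radical_sums.

(* A composition series of length k from 0 to N, all of whose terms satisfy L.
   With L trivial this is a composition series of N as a left module; with
   V = R^o and L = two_sided_ideal, one of N as an (R, R)-bimodule. *)
Definition composition_series (L : submodClosed V -> Prop) (N : {pred V})
    (k : nat) (C : nat -> submodClosed V) : Prop :=
  [/\ C 0%N =i pred1 0, C k =i N, forall i, (i <= k)%N -> L (C i)
    & forall i, (i < k)%N ->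
      [/\ {subset C i <= C i.+1}, ~ (C i =i C i.+1)
        & forall D : submodClosed V, L D ->
            {subset C i <= D} -> {subset D <= C i.+1} ->
            D =i C i \/ D =i C i.+1]].

(* V has finite length, equal to k. *)
Definition has_length (k : nat) : Prop :=
  exists C, composition_series (fun=> True) predT k C.

Definition length_le (n : nat) : Prop :=
  exists2 k, (k <= n)%N & has_length k.

End ModuleNotions.

Definition has_ideal_length (R : pzRingType) (I : submodClosed R^o)
    (n : nat) : Prop :=
  exists C, composition_series (@two_sided_ideal R) I n C.

Definition homomorphic_image (R : pzRingType) (V W : lmodType R) : Prop :=
  exists f : {linear V -> W}, forall y : W, exists x : V, f x = y.

(* Main.v *)
(* A family of left ideals with zero intersection has n members whose
   intersection contains no nonzero two-sided ideal: climb a bimodule composition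
   series of the socle, adding one member per step.
   For (i), apply this to the annihilators of the elements y of M with Ry/J(R)y
   simple; every nonzero a in R moves such a y because R is Artinian.  The
   submodule generated by the n chosen elements is faithful, with top of length
   at most n.
   For (ii), apply it dually to pairs (x, N) with M/N having a least nonzero
   submodule, and the left ideals of the a with ax in N; Zorn's lemma provides
   enough such N.  The quotient of M by the intersection of the n chosen N is
   faithful, and its socle embeds in the sum of n simple socles.
   For (iii), apply (ii) to the module given by (i): generation by n local
   elements passes to quotients. *)
Require Import Defs.
From HB Require Import structures.
From mathcomp Require Import all_boot all_algebra.
From mathcomp Require Import generic_quotient ring_quotient boolp.
From mathcomp Require classical_sets.

Set Implicit Arguments.
Unset Strict Implicit.
Unset Printing Implicit Defensive.

Import GRing.Theory.
Local Open Scope ring_scope.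

(** * Submodules cut out by predicates, and finite spans *)

Section Submodules.
Variables (R : pzRingType) (V : lmodType R).
Implicit Types (P : V -> Prop) (N : submodClosed V) (s : seq V).

Definition submod_prop P :=
  P 0 /\ forall a u v, P u -> P v -> P (a *: u + v).

Section MkSubmod.
Variables (P : V -> Prop) (HP : submod_prop P).

Definition mk_submod_pred of submod_prop P : {pred V} := fun v => `[< P v >].

Fact mk_submod_closed : submod_closed (mk_submod_pred HP).
Proof.
case: (HP) => P0 PL; split=> [|a u v /asboolP Pu /asboolP Pv]; apply/asboolP => //.
exact: PL.
Qed.

HB.instance Definition _ :=
  GRing.isSubmodClosed.Build R V (mk_submod_pred HP) mk_submod_closed.

Definition mk_submod : submodClosed V := mk_submod_pred HP.

Lemma mk_submodP v : reflect (P v) (v \in mk_submod).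
Proof. exact: asboolP. Qed.

End MkSubmod.

Lemma submodN N v : v \in N -> - v \in N.
Proof. by rewrite -scaleN1r; exact: rpredZ. Qed.

Lemma submodB N u v : u \in N -> v \in N -> u - v \in N.
Proof. by move=> uN vN; apply: rpredD => //; exact: submodN. Qed.

(** Peeling off one coefficient per entry lets spans be handled by induction on the list;
    [span_generated] recovers indexed coefficients. *)
Fixpoint in_span s (v : V) : Prop :=
  if s is w :: s' then exists a, in_span s' (v - a *: w) else v = 0.

Lemma in_span_prop s : submod_prop (in_span s).
Proof.
elim: s => [|w s [P0 PL]] /=; split.
- by [].
- by move=> a u v -> ->; rewrite scaler0 addr0.
- by exists 0; rewrite scale0r subr0.
move=> a u v [b Pu] [c Pv]; exists (a * b + c).
have -> : a *: u + v - (a * b + c) *: w = a *: (u - b *: w) + (v - c *: w).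
  by rewrite scalerBr scalerA scalerDl opprD !addrA; congr (_ + _); rewrite addrAC.
exact: PL.
Qed.

Definition submod_span s := mk_submod (in_span_prop s).

Lemma mem_span s v : v \in s -> v \in submod_span s.
Proof.
elim: s => // w s IH; rewrite inE => /orP[/eqP->|/IH/mk_submodP Pv].
  by apply/mk_submodP; exists 1; rewrite scale1r subrr; case: (in_span_prop s).
by apply/mk_submodP; exists 0; rewrite scale0r subr0.
Qed.

Lemma span_sub s N : {subset s <= N} -> {subset submod_span s <= N}.
Proof.
elim: s => [|w s IH] sN v /mk_submodP /= => [->|[a Pa]]; first exact: rpred0.
rewrite -(subrK (a *: w) v); apply: rpredD; last first.
  by apply: rpredZ; apply: sN; rewrite mem_head.
by apply: IH; [move=> x xs; apply: sN; rewrite inE xs orbT|exact/mk_submodP].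
Qed.

Lemma span_generated s : (forall v, v \in submod_span s) -> generated_by s.
Proof.
move=> sV v; have := sV v; move=> /mk_submodP; clear sV.
elim: s v => [|w s IH] v /=.
  by move=> ->; exists (fun=> 0); rewrite big_ord0.
move=> [a /IH[c Ec]].
exists (fun i => oapp c a (unlift ord0 i)).
rewrite big_ord_recl /= unlift_none /=.
under eq_bigr do rewrite liftK /=.
by rewrite -Ec addrC subrK.
Qed.

End Submodules.

(** * Quotient maps, lengths and the minimum condition *)

Lemma quotient_proj (R : pzRingType) (V : lmodType R) (N : submodClosed V) :
  exists f : {linear V -> quotient_module N},
    (forall y, exists x, f x = y) /\ (forall x, f x = 0 <-> x \in N).
Proof.
pose p (x : V) : quotient_module N := (\pi_(quotient_module N) x)%qT.
have linp : linear p.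
  move=> a u v; rewrite /p raddfD; congr (_ + _).
  exact/esym/pi_quotient_scale.
pose pl := GRing.isLinear.Build R V (quotient_module N) *:%R p linp.
pose f : {linear V -> quotient_module N} := HB.pack p pl.
exists f; split=> [y|x].
  by exists (repr y); rewrite /f /= /p reprK.
have := Quotient.idealrBE (zmod_of_submod N) x 0; rewrite subr0 => E.
have -> : (x \in N) = (p x == p 0) by exact: E.
have -> : p 0 = 0 by rewrite /p raddf0.
by split=> /eqP.
Qed.

(** Terms of [C] may repeat; deleting the repetitions, by induction on [k], leaves a composition
    series of length at most [k]. *)
Lemma chain_length_le (R : pzRingType) (V : lmodType R) (k : nat)
    (C : nat -> submodClosed V) :
  C 0 =i pred1 0 -> C k =i predT ->
  (forall i, (i < k)%N -> {subset C i <= C i.+1}) ->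
  (forall i, (i < k)%N -> forall D : submodClosed V,
     {subset C i <= D} -> {subset D <= C i.+1} -> D =i C i \/ D =i C i.+1) ->
  length_le V k.
Proof.
move=> C0 Ck incC simC.
suff [k' [lek' [D [D0 Dk _ Ds]]]] : exists k', (k' <= k)%N /\
    exists D, composition_series (fun=> True) (C k) k' D.
  by exists k' => //; exists D; split=> // x; rewrite Dk Ck.
clear Ck; elim: k incC simC => [|k IH] incC simC.
  by exists 0%N; split=> //; exists C; split.
have [||k' [lek' [D [D0 Dk DL Ds]]]] := IH.
- by move=> i lt; apply: incC; exact: leqW.
- by move=> i lt; apply: simC; exact: leqW.
have [eqC|neqC] := pselect (C k =i C k.+1).
  exists k'; split; first exact: leqW.
  by exists D; split=> // x; rewrite Dk eqC.
exists k'.+1; split=> //.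
exists (fun i => if (i <= k')%N then D i else C k.+1).
split=> //=; first by rewrite ltnn.
move=> i; rewrite ltnS => lei; rewrite lei.
have [lti|gei] := ltnP i k'; first exact: Ds.
have -> : i = k' by apply/eqP; rewrite eqn_leq lei gei.
split=> [x|eqD|E _ DE EC].
- by rewrite Dk; exact: incC.
- by apply: neqC => x; rewrite -Dk eqD.
have [||E1|E2] := simC k (ltnSn k) E => //.
- by move=> x xC; apply: DE; rewrite Dk.
- by left=> x; rewrite E1 Dk.
by right.
Qed.

Lemma length_leW (R : pzRingType) (V : lmodType R) (m n : nat) :
  (m <= n)%N -> length_le V m -> length_le V n.
Proof. by move=> mn [k km lk]; exists k => //; exact: leq_trans mn. Qed.

(** Without a minimal element below [I0], choice would produce a strictly descending sequence of
    left ideals. *)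
Lemma left_artinian_min (R : pzRingType) (artR : left_artinian R)
    (Q : submodClosed R^o -> Prop) (I0 : submodClosed R^o) :
  Q I0 -> exists I, [/\ Q I, {subset I <= I0} &
    forall D : submodClosed R^o, Q D -> {subset D <= I} -> D =i I].
Proof.
move=> QI0; apply: contrapT => noMin.
pose T := {I : submodClosed R^o | Q I /\ {subset I <= I0}}.
have step (I : T) : exists D : T, {subset sval D <= sval I} /\
    ~ (sval D =i sval I).
  case: I => I [QI II0] /=.
  apply: contrapT => noD; apply: noMin; exists I; split=> // D QD DI.
  apply: contrapT => neqD; apply: noD.
  have DI0 : {subset D <= I0} by move=> x /DI/II0.
  by exists (exist _ D (conj QD DI0)).
have [f fP] := choice step.
have I0T : T by exists I0; split.
pose I i := sval (iter i f I0T).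
have [|m Im] := artR I; first by move=> i; exact: (fP (iter i f I0T)).1.
exact: (fP (iter m f I0T)).2 (Im m.+1 (leqnSn m)).
Qed.

(** * Intersections and sums of submodules *)

Section MeetAdd.
Variables (R : pzRingType) (V : lmodType R).
Implicit Types N : submodClosed V.

Fact meet_prop (s : seq (submodClosed V)) :
  submod_prop (fun v => all (fun N : submodClosed V => v \in N) s).
Proof.
elim: s => [|N s [P0 PL]] //=; split=> [|a u v]; first by rewrite rpred0 P0.
move=> /andP[uN us] /andP[vN vs]; rewrite PL // andbT.
by apply: rpredD => //; exact: rpredZ.
Qed.

Definition meet_submod s := mk_submod (meet_prop s).

Lemma mem_meet s v :
  (v \in meet_submod s) = all (fun N : submodClosed V => v \in N) s.
Proof. exact/mk_submodP/idP. Qed.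

(** The boolean [all] lets these inclusions be combined with other properties of the members of [s]
    through [all_predI]. *)
Lemma meet_submod_sub s :
  all (fun N : submodClosed V => `[< {subset meet_submod s <= N} >]) s.
Proof.
have: forall v, v \in meet_submod s -> all (fun N : submodClosed V => v \in N) s.
  by move=> v; rewrite mem_meet.
move: (meet_submod s) => D; elim: s => //= N s IH DNs.
apply/andP; split; first by apply/asboolP => v /DNs/andP[].
by apply: IH => v /DNs/andP[].
Qed.

Fact add_prop (N1 N2 : submodClosed V) :
  submod_prop (fun v => exists2 x, x \in N1 & v - x \in N2).
Proof.
split=> [|a u v [x x1 x2] [y y1 y2]]; first by exists 0; rewrite ?subr0 rpred0.
exists (a *: x + y); first by apply: rpredD => //; exact: rpredZ.
by rewrite opprD addrACA -scalerBr; apply: rpredD => //; exact: rpredZ.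
Qed.

Definition add_submod N1 N2 := mk_submod (add_prop N1 N2).

Lemma add_submodl N1 N2 : {subset N1 <= add_submod N1 N2}.
Proof. by move=> x xN; apply/mk_submodP; exists x; rewrite ?subrr ?rpred0. Qed.

Lemma add_submodr N1 N2 : {subset N2 <= add_submod N1 N2}.
Proof. by move=> x xN; apply/mk_submodP; exists 0; rewrite ?subr0 ?rpred0. Qed.

Lemma add_submod_sub N1 N2 (D : submodClosed V) :
  {subset N1 <= D} -> {subset N2 <= D} -> {subset add_submod N1 N2 <= D}.
Proof.
move=> N1D N2D v /mk_submodP[x /N1D x1 /N2D x2].
by rewrite -(subrK x v); exact: rpredD.
Qed.

End MeetAdd.

(** * Two-sided ideals and the socle of the ring *)

Section IdealCore.
Variables (R : pzRingType) (L : submodClosed R^o).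

Fact ideal_core_prop :
  submod_prop (fun a : R^o => forall r : R, (a : R) * r \in L).
Proof.
split=> [r|a u v uL vL r]; first by rewrite mul0r; exact: rpred0.
rewrite mulrDl -mulrA; apply: rpredD => //.
exact: (@rpredZ _ _ L a (u * r)).
Qed.

(** The annihilator of the left module R/L, which is the largest two-sided ideal contained in
    [L]. *)
Definition ideal_core : submodClosed R^o := mk_submod ideal_core_prop.

Lemma ideal_coreP (a : R) :
  reflect (forall r : R, (a * r : R^o) \in L) ((a : R^o) \in ideal_core).
Proof. exact: mk_submodP. Qed.

Lemma ideal_core_two_sided : two_sided_ideal ideal_core.
Proof.
move=> a x /mk_submodP xL; apply/mk_submodP => r.
by rewrite -mulrA; exact: xL.
Qed.

End IdealCore.


Lemma two_sided_meet2 (R : pzRingType) (I J : submodClosed R^o) :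
  two_sided_ideal I -> two_sided_ideal J ->
  two_sided_ideal (meet_submod [:: I; J]).
Proof.
move=> tI tJ a x; rewrite !mem_meet /= => /and3P[xI xJ _].
by rewrite tI // tJ.
Qed.

Lemma two_sided_add (R : pzRingType) (I J : submodClosed R^o) :
  two_sided_ideal I -> two_sided_ideal J -> two_sided_ideal (add_submod I J).
Proof.
move=> tI tJ a x /mk_submodP[y yI yJ]; apply/mk_submodP.
by exists ((y : R) * a); [exact: tI|rewrite -mulrBl; exact: tJ].
Qed.

(** By the descending chain condition a nonzero [I] contains a minimal two-sided ideal, and that
    ideal lies in the socle. *)
Lemma ring_socle_essential (R : pzRingType) (I : submodClosed R^o) :
  left_artinian R -> two_sided_ideal I ->
  (forall a : R, (a : R^o) \in I -> (a : R^o) \in ring_socle R -> a = 0) ->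
  forall a : R, (a : R^o) \in I -> a = 0.
Proof.
move=> artR tI IS a aI; apply: contrapT => a0.
pose Q (D : submodClosed R^o) := two_sided_ideal D /\ exists2 x, x \in D & x != 0.
have QI : Q I by split=> //; exists a => //; exact/eqP.
have [D [[tD [x xD x0]] DI minD]] := left_artinian_min artR QI.
suff mD : minimal_ideal D.
  move/eqP: x0; apply; apply: IS; first exact: DI.
  apply/asboolP; exists [:: (x : R^o)]; rewrite big_seq1; split=> // y.
  by rewrite inE => /eqP->; exists D.
split=> // [D0|E tE ED]; first by move: xD; rewrite D0 inE (negbTE x0).
have [[y yE y0]|noE] := pselect (exists2 y, y \in E & y != 0).
  by right; apply: minD => //; split=> //; exists y.
left=> y; rewrite inE; apply/idP/eqP => [yE|->]; last exact: rpred0.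
by apply: contrapT => /eqP y0; apply: noE; exists y.
Qed.

(* Adding one left ideal of the family at each step of a bimodule composition
   series of the socle suffices: if the core chosen so far meets C_j trivially,
   then its intersection with C_(j+1) is zero or a simple bimodule. *)
Lemma finite_separation (R : pzRingType) (n : nat) (T : Type)
    (L : T -> submodClosed R^o) :
  left_artinian R -> has_ideal_length (ring_socle R) n ->
  (forall a : R, a <> 0 -> exists t, (a : R^o) \notin L t) ->
  exists2 s : seq T, (size s <= n)%N &
    forall a : R, (a : R^o) \in ideal_core (meet_submod (map L s)) -> a = 0.
Proof.
move=> artR [C [C0 Cn tC simC]] sepL.
suff H j : (j <= n)%N -> exists2 s : seq T, (size s <= j)%N &
    forall a : R, (a : R^o) \in C j ->
      (a : R^o) \in ideal_core (meet_submod (map L s)) -> a = 0.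
  have [s sn sP] := H n (leqnn n); exists s => //.
  apply: ring_socle_essential => //; first exact: ideal_core_two_sided.
  by move=> a acore aS; apply: sP => //; rewrite Cn.
elim: j => [_|j IH ltj].
  by exists [::] => // a; rewrite C0 inE => /eqP.
have [s sj sP] := IH (ltnW ltj).
pose K s := ideal_core (meet_submod (map L s)).
have tK s' : two_sided_ideal (K s') by exact: ideal_core_two_sided.
have [sP'|] := pselect (forall a : R, (a : R^o) \in C j.+1 ->
  (a : R^o) \in K s -> a = 0).
  by exists s => //; exact: leqW.
(* Some nonzero [a] lies in both [C j.+1] and [K s]; the new index [t] is chosen so that [L t]
   misses [a]. *)
move=> /existsNP[a /not_implyP[aC /not_implyP[aK /sepL[t at_]]]].
have Kt (b : R^o) : b \in K (t :: s) -> b \in K s /\ b \in L t.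
  move=> /ideal_coreP bK; split.
    by apply/ideal_coreP => r; move: (bK r); rewrite !mem_meet /= => /andP[].
  by move: (bK 1); rewrite mem_meet mulr1 => /andP[].
exists (t :: s) => // b bC bK.
have [subC _ sim] := simC j ltj.
pose I := meet_submod [:: C j.+1; K (t :: s)].
have tI : two_sided_ideal I by apply: two_sided_meet2 => //; exact: tC.
have bI : (b : R^o) \in I by rewrite mem_meet /= bC bK.
(* Simplicity of C_(j+1)/C_j leaves two cases. If C_j + I = C_j, then [b] lies in [C j] and in
   [K s], hence vanishes. *)
have [|||E|E] := sim (add_submod (C j) I).
- by apply: two_sided_add => //; apply: tC; exact: ltnW.
- exact: add_submodl.
- by apply: add_submod_sub => // x; rewrite mem_meet => /and3P[].
- by apply: sP; [rewrite -E; exact: add_submodr|case: (Kt _ bK)].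
(* If C_j + I = C_(j+1), then [a] is [c] plus an element of [I]. Both [a] and that element lie in
   [K s], hence so does [c]; thus c = 0 and [a] lies in [L t], a contradiction. *)
have := aC; rewrite -E => /mk_submodP[c cC]; rewrite mem_meet => /and3P[_ acK _].
have [acs acL] := Kt _ acK.
have c0 : c = 0.
  apply: sP => //; rewrite -[c](subKr a); exact: submodB.
by move: at_; rewrite -[a](subr0 a) -c0 acL.
Qed.

(** * Maximal left ideals and the Jacobson radical *)

Lemma maximal_left_ideal_complement (R : pzRingType) (m : submodClosed R^o)
    (x : R) :
  maximal_left_ideal m -> (x : R^o) \notin m ->
  forall e : R, exists a : R, (e - a * x : R^o) \in m.
Proof.
move=> [_ maxm] xm e.
have [Dm|DT] := maxm (add_submod m (submod_span [:: (x : R^o)])) (@add_submodl _ _ _ _).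
  by case/negP: xm; rewrite -Dm; apply: add_submodr; apply: mem_span; rewrite mem_head.
have : (e : R^o) \in add_submod m (submod_span [:: (x : R^o)]) by rewrite DT.
move=> /mk_submodP[y ym /mk_submodP[a /= /eqP]].
rewrite subr_eq0 => /eqP E; exists a.
suff -> : (e - a * x : R) = (y : R) by [].
by rewrite -[a * x]E subKr.
Qed.

(* E is a left ideal minimal for T + E = R: if x in T and E avoids a maximal
   left ideal m, then E = Rx + (E and m), so that (E and m) could replace E. *)
Lemma complement_mod_radical (R : pzRingType) (T : submodClosed R^o) :
  left_artinian R ->
  exists E : submodClosed R^o,
    (exists2 e : R, (e : R^o) \in E & (1 - e : R^o) \in T) /\
    forall x : R, (x : R^o) \in T -> (x : R^o) \in E -> jacobson_radical x.
Proof.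
move=> artR.
pose Q (E : submodClosed R^o) :=
  exists2 e : R, (e : R^o) \in E & (1 - e : R^o) \in T.
have QR : Q (meet_submod [::]) by exists 1; rewrite ?mem_meet // subrr rpred0.
have [E [[e eE eT] _ minE]] := left_artinian_min artR QR.
exists E; split; first by exists e.
move=> x xT xE m maxm; apply: contrapT => /negP xm.
have [a em] := maximal_left_ideal_complement maxm xm e.
have axT : (a * x : R^o) \in T by exact: (@rpredZ _ _ T a x).
have axE : (a * x : R^o) \in E by exact: (@rpredZ _ _ E a x).
(* The element e - ax lies in E and in m, and 1 - (e - ax) = (1 - e) + ax lies in T. Minimality then
   gives E inside m, contradicting the choice of m. *)
have EE : meet_submod [:: E; m] =i E.
  apply: minE => [|y]; last by rewrite mem_meet => /and3P[].
  exists (e - a * x).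
    by rewrite mem_meet /= em andbT andbT; apply: (@submodB _ _ E).
  rewrite opprB addrCA addrC; exact: (@rpredD _ T).
by have := xE; rewrite -EE mem_meet /= (negbTE xm) andbF.
Qed.

(** * Local elements and the length of the top *)

Section LocalElements.
Variable R : pzRingType.

(* Equivalent to: Ry / J(R)y is simple or zero. *)
Definition local_element (V : lmodType R) (y : V) : Prop :=
  forall r : R, (exists2 j, jacobson_radical j & r *: y = j *: y) \/
    exists s : R, s *: (r *: y) = y.

(** The condition consists of equations inside Ry with coefficients in R, so every linear map
    preserves it, and an injective one reflects it. *)
Lemma local_element_morph (V W : lmodType R) (f : {linear V -> W}) (y : V) :
  local_element y -> local_element (f y).
Proof.
move=> locy r; have [[j Jj E]|[s E]] := locy r.
  by left; exists j; rewrite // -!linearZ E.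
by right; exists s; rewrite -!linearZ E.
Qed.

Lemma local_element_inj (V W : lmodType R) (f : {linear V -> W}) (y : V) :
  injective f -> local_element (f y) -> local_element y.
Proof.
move=> injf locy r; have [[j Jj E]|[s E]] := locy r.
  by left; exists j; rewrite //; apply: injf; rewrite !linearZ.
by right; exists s; apply: injf; rewrite !linearZ.
Qed.

(* For r in a left ideal I minimal with a I x <> 0 and a r x <> 0, the
   submodule R r x is not a sum of proper submodules, as a kills those. *)
Lemma exists_local_element (V : lmodType R) (a : R) (x : V) :
  left_artinian R -> a *: x <> 0 ->
  exists2 y : V, local_element y & a *: y <> 0.
Proof.
move=> artR ax.
pose Q (I : submodClosed R^o) := exists2 r : R, (r : R^o) \in I & a *: (r *: x) <> 0.
have QR : Q (meet_submod [::]) by exists 1; rewrite ?mem_meet // scale1r.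
have [I [[r rI arx] _ minI]] := left_artinian_min artR QR.
set y := r *: x in arx; exists y => //.
have PT : submod_prop (fun b : R^o => forall c : R, a *: (c *: ((b : R) *: y)) = 0).
  split=> [c|d u v uT vT c]; first by rewrite scale0r !scaler0.
  have -> : (d *: u + v : R) *: y = d *: ((u : R) *: y) + (v : R) *: y.
    by rewrite scalerDl -scalerA.
  by rewrite !scalerDr vT [c *: _]scalerA uT addr0.
pose T := mk_submod PT.
(* For b outside T, [a] does not kill R b r x, so minimality of I forces R b r = I; hence r lies in
   R b r and y in R b y. *)
have notT (b : R) : (b : R^o) \notin T -> exists d : R, d *: (b *: y) = y.
  move=> /mk_submodP/existsNP[c acby].
  have brI : (b * r : R^o) \in I by exact: (@rpredZ _ _ I b r).
  have E : submod_span [:: (b * r : R^o)] =i I.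
    apply: minI; last by apply: span_sub => z; rewrite inE => /eqP->.
    exists (c * (b * r)); last by rewrite -!scalerA.
    exact: (@rpredZ _ _ _ c (b * r : R^o) (mem_span (mem_head _ _))).
  move: rI; rewrite -E => /mk_submodP[d /= /eqP]; rewrite subr_eq0 => /eqP rE.
  by exists d; rewrite /y {2}[r]rE -!scalerA.
have [E [[e eE eT] TEJ]] := complement_mod_radical T artR.
have nT1 : (1 : R^o) \notin T.
  by apply/negP => /mk_submodP/(_ 1); rewrite !scale1r.
(* From 1 = (1 - e) + e, with 1 outside T and 1 - e in T, it follows that e is outside T. *)
have [d dey] : exists d : R, d *: (e *: y) = y.
  apply: notT; apply: contra nT1 => eT'.
  by rewrite -[1](subrK (e : R^o)); exact: rpredD.
move=> q; have [qT|/notT[s sqy]] := boolP ((q : R^o) \in T); last by right; exists s.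
(* As d e y = y, the coefficient q d e acts on y as q does. It lies in E, and in T because q does,
   hence in J(R). *)
left; exists (q * d * e); last by rewrite -!scalerA dey.
apply: TEJ; last exact: (@rpredZ _ _ E (q * d) e).
apply/mk_submodP => c; rewrite -!scalerA dey; move/mk_submodP: qT; exact.
Qed.

Lemma in_span_morph (V W : lmodType R) (f : {linear V -> W}) (s : seq V) v :
  v \in submod_span s -> f v \in submod_span (map f s).
Proof.
move=> /mk_submodP vs; apply/mk_submodP; elim: s v vs => [|w s IH] v /=.
  by move=> ->; rewrite linear0.
by move=> [a /IH]; rewrite linearB linearZ => H; exists a.
Qed.

Lemma in_span_inj (V W : lmodType R) (f : {linear V -> W}) (s : seq V) v :
  injective f -> f v \in submod_span (map f s) -> v \in submod_span s.
Proof.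
move=> injf /mk_submodP vs; apply/mk_submodP; elim: s v vs => [|w s IH] v /=.
  by move=> v0; apply: injf; rewrite v0 linear0.
by move=> [a vs]; exists a; apply: IH; rewrite linearB linearZ.
Qed.

(** The chain adds the image of one generator at a time. Each factor is generated by the image of a
    local element and killed by J(R), hence simple or zero. *)
Lemma top_length_le (V : lmodType R) (s : seq V) :
  (forall v, v \in submod_span s) -> {in s, forall y, local_element y} ->
  length_le (quotient_module (radical_submod V)) (size s).
Proof.
move=> genV locs.
have [f [surf kerf]] := quotient_proj (radical_submod V).
(* [rev] puts the newest generator at the head, where [in_span] peels it off. *)
pose C i := submod_span (rev (take i (map f s))).
have Ckill (y : V) (j : R) : jacobson_radical j -> j *: f y = 0.
  move=> Jj; rewrite -linearZ; apply/kerf/asboolP.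
  by exists [:: (j, y)]; rewrite big_seq1; split=> // p; rewrite inE => /eqP->.
have CS i : (i < size s)%N -> exists2 y, y \in s &
    rev (take i.+1 (map f s)) = f y :: rev (take i (map f s)).
  move=> lti; exists s`_i; first exact: mem_nth.
  by rewrite (take_nth 0) ?size_map // rev_rcons (nth_map 0).
apply: (@chain_length_le _ _ _ C) => [v|v|i lti|i lti D].
- rewrite /C take0 inE; apply/mk_submodP/eqP => //=.
- rewrite inE /C take_oversize ?size_map //; have [x <-] := surf v.
  have := in_span_morph f (genV x); apply: span_sub => {}v vs.
  by apply: mem_span; rewrite mem_rev.
- have [y _ E] := CS i lti; rewrite /C E; apply: span_sub => v vs.
  by apply: mem_span; rewrite inE vs orbT.
have [y ys E] := CS i lti; rewrite {1 2 3 4}/C E => CD DC.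
have [DC'|] := pselect {subset D <= C i}.
  by left=> v; apply/idP/idP => [/DC'|/CD].
move=> /existsNP[d /not_implyP[dD dC]]; right=> v; apply/idP/idP => [/DC//|].
apply: span_sub => {}v; rewrite inE => /orP[/eqP->|vs]; last first.
  by apply: CD; exact: mem_span.
have /mk_submodP/= [r /mk_submodP Cd] := DC d dD.
(* Here d is congruent to r f(y) modulo C_i. If r acts on y as an element of J(R), then r f(y) = 0
   and d is in C_i; otherwise t d is congruent to f(y), so f(y) is in D. *)
have [[j Jj rj]|[t tr]] := locs y ys r.
  have r0 : r *: f y = 0 by rewrite -linearZ /= rj linearZ /= Ckill.
  by case: dC; rewrite r0 subr0 in Cd; exact: Cd.
have -> : f y = t *: d - t *: (d - r *: f y) by rewrite scalerBr subKr -!linearZ tr.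
by apply: submodB; apply: rpredZ => //; apply: CD; exact: Cd.
Qed.

End LocalElements.

Lemma submodule_span_generated (R : pzRingType) (V : lmodType R) (s : seq V) :
  exists2 t : seq (submodule (submod_span s)), map val t = s &
    forall v, v \in submod_span t.
Proof.
pose N := submod_span s.
have sN : all (fun v => v \in N) s by apply/allP => v; exact: mem_span.
(* Every entry of [s] lies in [N], so [pmap insub] discards nothing. *)
pose t : seq (submodule N) := pmap insub s.
have vE : map val t = s.
  rewrite pmap_filter; last exact: insubK.
  by apply/all_filterP; apply: sub_all sN => v vN; rewrite insubT.
exists t => // v.
apply: (in_span_inj (f := val)); first exact: val_inj.
by rewrite vE; exact: submodule_valP.
Qed.

Lemma faithful_local_submodule (R : pzRingType) (n : nat) (M : lmodType R) :
  left_artinian R -> has_ideal_length (ring_socle R) n -> faithful M ->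
  exists2 M' : submodClosed M, faithful (submodule M') &
    exists s : seq (submodule M'), [/\ (size s <= n)%N,
      forall v, v \in submod_span s & {in s, forall y, local_element y}].
Proof.
move=> artR lenR faithM.
have annP (y : M) : submod_prop (fun a : R^o => (a : R) *: y = 0).
  split=> [|a u v u0 v0]; first by rewrite scale0r.
  by rewrite scalerDl -scalerA u0 v0 scaler0 addr0.
pose T := {y : M | local_element y}.
pose L (t : T) := mk_submod (annP (sval t)).
have [|s sn sP] := @finite_separation R n T L artR lenR.
  move=> a a0; have [x ax] : exists x : M, a *: x <> 0.
    by apply/existsNP => /faithM.
  have [y locy ay] := exists_local_element artR ax.
  by exists (exist _ y locy); apply/negP => /mk_submodP.
pose ys := map sval s; exists (submod_span ys).
  (* If [a] kills the span, then a r y = 0 for every r and every chosen y, so [a] lies in the core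
     of the intersection of the annihilators. *)
  move=> a aM; apply: sP; apply/ideal_coreP => r; rewrite mem_meet all_map.
  have: {subset ys <= submod_span ys} by move=> y; exact: mem_span.
  rewrite {1}/ys; elim: (s) => //= t s' IH sub; apply/andP; split; last first.
    by apply: IH => y ys'; apply: sub; rewrite inE ys' orbT.
  have yM : r *: sval t \in submod_span ys.
    by apply: rpredZ; apply: sub; exact: mem_head.
  apply/mk_submodP; rewrite -scalerA.
  by have := congr1 val (aM (Submodule yM)).
have locys : {in ys, forall y, local_element y}.
  rewrite /ys; elim: (s) => //= t s' IH y.
  by rewrite inE => /orP[/eqP->|/IH//]; exact: svalP.
have [t tE tgen] := submodule_span_generated ys.
exists t; split=> //.
  by rewrite -(size_map val) tE size_map.
move=> y yt; apply: (local_element_inj (f := val)); first exact: val_inj.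
have : val y \in map val t by exact: map_f.
by rewrite tE => /locys.
Qed.

(** * Monolithic quotients and small socles *)

(* V/N has a least nonzero submodule, generated by the image of x. *)
Definition monolithic_quotient (R : pzRingType) (V : lmodType R)
    (N : submodClosed V) : Prop :=
  exists2 x, x \notin N &
    forall w, w \notin N -> exists r : R, x - r *: w \in N.

(** Intersect the socle with fewer and fewer members of [s]. Each factor of this chain embeds, for
    some N in [s], in the least nonzero submodule of V/N, hence is simple or zero. *)
Lemma length_socle_le (R : pzRingType) (V : lmodType R)
    (s : seq (submodClosed V)) :
  (forall v, v \in meet_submod s -> v = 0) ->
  all (fun N : submodClosed V => `[< monolithic_quotient N >]) s ->
  length_le (submodule (socle V)) (size s).
Proof.
move=> s0 irrs.
have pP i : submod_prop (fun v : submodule (socle V) => val v \in meet_submod (drop i s)).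
  split=> [|a u v us vs]; first by rewrite linear0 rpred0.
  by rewrite linearD linearZ; apply: rpredD => //; exact: rpredZ.
pose C i := mk_submod (pP i).
have Cin i v : (v \in C i) = (val v \in meet_submod (drop i s)).
  exact/mk_submodP/idP.
have CS i : (i < size s)%N -> exists N : submodClosed V,
    monolithic_quotient N /\
    forall v, (v \in C i) = (val v \in N) && (v \in C i.+1).
  move=> lti; exists (nth (socle V) s i); split.
    by move: irrs => /(all_nthP (socle V))/(_ i lti)/asboolP.
  by move=> v; rewrite !Cin (drop_nth (socle V) lti) !mem_meet.
(* Modulo N, each simple X maps into R x: either X lies in N, or some z in X outside N has a
   multiple r z congruent to x, and r z generates X. *)
have socN (N : submodClosed V) x : x \notin N ->
   (forall w, w \notin N -> exists r : R, x - r *: w \in N) ->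
   forall v, v \in socle V -> exists a : R, v - a *: x \in N.
  move=> xN irrN v /asboolP[t [tS ->]].
  elim: t tS => [|w t IH] tS.
    by exists 0; rewrite big_nil scale0r subr0 rpred0.
  have [|b tb] := IH; first by move=> z zt; apply: tS; rewrite inE zt orbT.
  have [c wc] : exists c : R, w - c *: x \in N.
    have [X [X0 simX] wX] := tS w (mem_head _ _).
    have [XN|] := pselect {subset X <= N}.
      by exists 0; rewrite scale0r subr0 XN.
    move=> /existsNP[z /not_implyP[zX /negP zN]].
    have [r xrz] := irrN z zN.
    have rzN : r *: z \notin N.
      by apply: contra xN => rzN; rewrite -(subrK (r *: z) x); exact: rpredD.
    have [||E] := simX (submod_span [:: r *: z]).
    - by apply: span_sub => u; rewrite inE => /eqP->; exact: rpredZ.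
    - move=> /(_ (r *: z)); rewrite mem_span ?mem_head // inE => /esym/eqP E.
      by rewrite E rpred0 in rzN.
    move: wX; rewrite -E => /mk_submodP[c /= /eqP]; rewrite subr_eq0 => /eqP wE.
    by exists c; rewrite wE -scalerBr -opprB scalerN submodN //; exact: rpredZ.
  exists (c + b); rewrite big_cons scalerDl opprD addrACA.
  exact: rpredD.
apply: (@chain_length_le _ _ _ C) => [v|v|i lti v|i lti D CD DC].
- rewrite Cin drop0 inE; apply/idP/eqP => [/s0 v0|->]; last by rewrite linear0 rpred0.
  by apply: val_inj; rewrite v0 linear0.
- by rewrite Cin drop_size mem_meet.
- by have [N [_ ->]] := CS i lti => /andP[].
have [N [[x xN irrN] CN]] := CS i lti.
have [DC'|] := pselect {subset D <= C i}.
  by left=> v; apply/idP/idP => [/DC'|/CD].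
move=> /existsNP[d /not_implyP[dD /negP]]; rewrite CN (DC d dD) andbT => dN.
right=> v; apply/idP/idP => [/DC//|vC].
have [a va] := socN N x xN irrN (val v) (submodule_valP v).
have [r xrd] := irrN _ dN.
(* Modulo N, v is congruent to a x and hence to a r d; so v - a r d falls into C_i, which D
   contains. *)
rewrite -(subrK ((a * r) *: d) v); apply: rpredD; last exact: rpredZ.
apply: CD; rewrite CN; apply/andP; split; last first.
  by apply: submodB => //; apply: rpredZ; exact: DC.
have -> : val (v - (a * r) *: d) = (val v - a *: x) + a *: (x - r *: val d).
  by rewrite scalerBr addrA subrK scalerA.
by apply: rpredD => //; exact: rpredZ.
Qed.

(** Zorn's lemma gives [N] maximal among the submodules missing [x]; for w outside N, maximality
    puts x in N + Rw. Inclusion is treated as a preorder, since two terms may denote the same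
    submodule. *)
Lemma exists_submod_avoiding (R : pzRingType) (V : lmodType R) (x : V) :
  x <> 0 -> exists2 N : submodClosed V, x \notin N &
    forall w, w \notin N -> exists r : R, x - r *: w \in N.
Proof.
move=> x0.
pose T := {N : submodClosed V | x \notin N}.
pose toT (N : submodClosed V) (xN : x \notin N) : T := exist _ N xN.
pose le (A B : T) : bool := `[< {subset sval A <= sval B} >].
have T0 : T.
  exists (submod_span [::]); apply/negP => /mk_submodP; exact: x0.
have [||A totA|[N xN] maxN] := @classical_sets.ZL_preorder T T0 le.
- by move=> N; apply/asboolP.
- by move=> N1 N2 N3 /asboolP H1 /asboolP H2; apply/asboolP => v /H1/H2.
(* The clause v = 0 keeps the union a submodule when the chain is empty. *)
- have UP : submod_prop (fun v => v = 0 \/ exists2 N : T, A N & v \in sval N).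
    split; first by left.
    move=> a u v [->|[N1 A1 u1]] [->|[N2 A2 v2]].
    + by left; rewrite scaler0 addr0.
    + by right; exists N2; rewrite // scaler0 add0r.
    + by right; exists N1; rewrite // addr0; exact: rpredZ.
    right; case: (totA _ _ A1 A2) => /asboolP H.
      by exists N2; rewrite // rpredD // rpredZ // H.
    by exists N1; rewrite // rpredD // ?rpredZ // H.
  have xU : x \notin mk_submod UP.
    by apply/negP => /mk_submodP[//|[[N xN] _ /=]]; exact/negP.
  exists (toT _ xU) => N AN; apply/asboolP => v vN /=.
  by apply/mk_submodP; right; exists N.
exists N => // w wN; apply: contrapT => noR.
have xD : x \notin add_submod N (submod_span [:: w]).
  apply/negP => /mk_submodP[y yN /mk_submodP[r /= /eqP]].
  rewrite subr_eq0 => /eqP E; apply: noR; exists r.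
  by rewrite -E subKr.
have /asboolP/= H := maxN (toT _ xD) (asboolT (@add_submodl _ _ _ _)).
case/negP: wN; apply: H.
by apply: (@add_submodr _ _ N (submod_span [:: w])); apply: mem_span; rewrite mem_head.
Qed.

Lemma faithful_small_socle_quotient (R : pzRingType) (n : nat) (M : lmodType R) :
  left_artinian R -> has_ideal_length (ring_socle R) n -> faithful M ->
  exists2 N : submodClosed M, faithful (quotient_module N) &
    length_le (submodule (socle (quotient_module N))) n.
Proof.
move=> artR lenR faithM.
pose T := {p : M * submodClosed M | monolithic_quotient p.2}.
have LP (t : T) : submod_prop (fun a : R^o => (a : R) *: (sval t).1 \in (sval t).2).
  split=> [|a u v u0 v0]; first by rewrite scale0r rpred0.
  by rewrite scalerDl -scalerA rpredD // rpredZ.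
pose L t := mk_submod (LP t).
have [|s sn sP] := @finite_separation R n T L artR lenR.
  move=> a a0; have [x ax] : exists x : M, a *: x <> 0.
    by apply/existsNP => /faithM.
  have [N axN irrN] := exists_submod_avoiding ax.
  (* The pair stores [x], while [a *: x] generates the least nonzero submodule of M/N; hence the
     left ideal of the pair misses [a]. *)
  have tP : monolithic_quotient (x, N).2 by exists (a *: x).
  by exists (exist _ (x, N) tP); apply/negP => /mk_submodP; apply/negP.
pose Ns := [seq (sval t).2 | t <- s].
pose N := meet_submod Ns.
have [f [surf kerf]] := quotient_proj N.
exists N.
  move=> a aM; apply: sP; apply/ideal_coreP => r; rewrite mem_meet all_map.
  have : forall x, a *: x \in N by move=> x; apply/kerf; rewrite linearZ /= aM.
  rewrite /N /Ns => {}aM; have {aM} : forall x : M,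
      all (fun t : T => a *: x \in (sval t).2) s.
    by move=> x; move: (aM x); rewrite mem_meet all_map.
  elim: (s) => //= t s' IH aM; apply/andP; split.
    by apply/mk_submodP; rewrite -scalerA; case/andP: (aM (r *: (sval t).1)).
  by apply: IH => x; case/andP: (aM x).
have imP (A : submodClosed M) :
    submod_prop (fun y => exists2 x, f x = y & x \in A).
  split=> [|a u v [x <- xA] [y <- yA]]; first by exists 0; rewrite ?linear0 ?rpred0.
  by exists (a *: x + y); rewrite ?linearP // rpredD // rpredZ.
pose im A := mk_submod (imP A).
apply: length_leW (_ : (size (map im Ns) <= n)%N) _; first by rewrite !size_map.
(* As A contains N, the kernel of f, it is the full preimage of its image. This carries the zero
   intersection and the monolithic quotients over to M/N. *)
have imE (A : submodClosed M) : {subset N <= A} -> forall x, (f x \in im A) = (x \in A).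
  move=> NA x; apply/mk_submodP/idP => [[z E zA]|]; last by exists x.
  rewrite -(subKr z x); apply: submodB => //; apply: NA; apply/kerf.
  by rewrite linearB E subrr.
have subN := meet_submod_sub Ns.
apply: length_socle_le.
  move=> y; have [x <-] := surf y; rewrite mem_meet all_map => imx.
  apply/kerf; rewrite mem_meet.
  have : all (predI (fun A : submodClosed M => `[< {subset N <= A} >])
      (fun A => f x \in im A)) Ns by rewrite all_predI subN.
  by apply: sub_all => A /andP[/asboolP NA] /=; rewrite imE.
have irrs : all (fun A : submodClosed M => `[< monolithic_quotient A >]) Ns.
  by rewrite all_map; elim: (s) => //= t s' ->; rewrite andbT; apply/asboolP; exact: svalP t.
rewrite all_map.
have : all (predI (fun A : submodClosed M => `[< {subset N <= A} >])
    (fun A => `[< monolithic_quotient A >])) Ns by rewrite all_predI subN.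
apply: sub_all => A /andP[/asboolP NA /asboolP[x xA irrA]] /=; apply/asboolP.
exists (f x); first by rewrite imE.
move=> y; have [w <-] := surf y; rewrite imE // => /irrA[r xrw].
by exists r; rewrite -linearZ -linearB imE.
Qed.

Theorem proposition17 (R : pzRingType) (n : nat) (M : lmodType R)
  (artR : left_artinian R)
  (lenR : has_ideal_length (ring_socle R) n)
  (faithM : faithful M) :
  [/\ exists M' : submodClosed M,
        [/\ faithful (submodule M'),
            length_le (quotient_module (radical_submod (submodule M'))) n
          & exists2 s : seq (submodule M'), (size s <= n)%N & generated_by s],
      exists M'' : lmodType R,
        [/\ homomorphic_image M M'',
            faithful M''
          & length_le (submodule (socle M'')) n]
    & exists (M' : submodClosed M) (P : lmodType R),
        [/\ homomorphic_image (submodule M') P,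
            faithful P,
            length_le (quotient_module (radical_submod P)) n
          & length_le (submodule (socle P)) n]].
Proof.
have [M' faithM' [s [sn genM' locs]]] := faithful_local_submodule artR lenR faithM.
split.
- exists M'; split=> //; first exact: length_leW sn (top_length_le genM' locs).
  by exists s => //; exact: span_generated.
- have [N faithN lenN] := faithful_small_socle_quotient artR lenR faithM.
  have [f [surf _]] := quotient_proj N.
  by exists (quotient_module N); split=> //; exists f.
have [N faithN lenN] := faithful_small_socle_quotient artR lenR faithM'.
have [f [surf _]] := quotient_proj N.
exists M', (quotient_module N); split=> //; first by exists f.
apply: (length_leW (m := size (map f s))); first by rewrite size_map.
apply: top_length_le => [y|_ /mapP[y ys ->]].
  by have [x <-] := surf y; exact: in_span_morph.
by apply: local_element_morph; exact: locs.
Qed.
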